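(* Let $G$ be a locally profinite group, let $H$ and $K$ be closed subgroups of $G$, and let $\rho$ be a smooth representation of $H$ over some commutative ring $R$ with unit. (1) If either $H$ or $K$ is open in $G$, then we have the Mackey decomposition (an isomorphism of $K$-representations) \[ \mathrm{Res}_{K}^{G}\, \mathrm{c\text{-}Ind}_{H}^{G}\, \rho \;\cong\; \bigoplus_{g \in K \backslash G / H} \mathrm{c\text{-}Ind}_{K \cap {}^{g}H}^{K}\, \mathrm{Res}_{K \cap {}^{g}H}^{{}^{g}H}\, {}^{g}\rho . \] (2) If $K$ is open in $G$, then we have the Mackey decomposition (an isomorphism of $K$-representations) \[ \mathrm{Res}_{K}^{G}\, \mathrm{Ind}_{H}^{G}\, \rho \;\cong\; \Bigl( \prod_{g \in K \backslash G / H} \mathrm{Ind}_{K \cap {}^{g}H}^{K}\, \mathrm{Res}_{K \cap {}^{g}H}^{{}^{g}H}\, {}^{g}\rho \Bigr)^{\infty}. \] (3) If we omit the assumption that $K$ is open, there exists an example (of $G, H, K, R, \rho$ as in the first sentence) such that $H$ is open in $G$ and the isomorphism in (2) does not hold.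
   Context: Representations are on $R$-modules. A representation of a topological group is smooth if every vector is fixed by some open subgroup. For a representation $\tau$ of $K$, $\tau^{\infty}$ denotes its $K$-smooth part, i.e. the subrepresentation of vectors fixed by some open subgroup of $K$. For a closed subgroup $H$ of a locally profinite group $G$ and a smooth $H$-representation $(\rho, V)$ over $R$, let $\mathrm{IND}_{H}^{G}(\rho)$ be the set of functions $f \colon G \to V$ with $f(hg)=\rho(h)f(g)$ for all $h \in H$, $g \in G$, with $G$ acting by right translation. The induction $\mathrm{Ind}_{H}^{G}\rho$ is the $G$-smooth part of $\mathrm{IND}_{H}^{G}(\rho)$. The compact induction $\mathrm{c\text{-}Ind}_{H}^{G}\rho$ is the subrepresentation of those $f \in \mathrm{Ind}_{H}^{G}\rho$ whose support is compact modulo $H$ (its image in $H\backslash G$ is compact). $\mathrm{Res}$ denotes restriction to a subgroup. For $g \in G$, ${}^{g}H := gHg^{-1}$, and ${}^{g}\rho$ is the representation of ${}^{g}H$ on $V$ given by ${}^{g}\rho(h') = \rho(g^{-1}h'g)$ for $h' \in {}^{g}H$. In sums and products over $K \backslash G/H$, $g$ runs over a set of representatives of the double cosets. *)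

(* Defs.v *)
From HB Require Import structures.
From mathcomp Require Import all_boot all_order all_algebra.
From mathcomp Require Import all_classical all_reals all_analysis.

Set Implicit Arguments.
Unset Strict Implicit.
Unset Printing Implicit Defensive.

Import GRing.Theory.

Local Open Scope classical_set_scope.
Local Open Scope quotient_scope.
Local Open Scope group_scope.

HB.mixin Record isTopologicalGroup G & Group G & Topological G := {
  mulg_continuous : continuous (fun x : G * G => x.1 * x.2);
  invg_continuous : continuous (fun x : G => x^-1)
}.

#[short(type="topGroupType")]
HB.structure Definition TopologicalGroup :=
  {G of isTopologicalGroup G & Group G & Topological G}.

Section Translations.
Variable (G : topGroupType) (g : G).

Lemma mulg_continuousl : continuous (fun x : G => g * x).
Proof.
move=> x; apply: (@continuous_comp _ _ _ (fun x => (g, x))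
  (fun x : G * G => x.1 * x.2)); last exact: mulg_continuous.
by apply: cvg_pair; [exact: cvg_cst | exact: cvg_id].
Qed.

Lemma mulg_continuousr : continuous (fun x : G => x * g).
Proof.
move=> x; apply: (@continuous_comp _ _ _ (fun x => (x, g))
  (fun x : G * G => x.1 * x.2)); last exact: mulg_continuous.
by apply: cvg_pair; [exact: cvg_id | exact: cvg_cst].
Qed.

End Translations.

Record subgroup (G : groupType) := Subgroup {
  sg_set :> set G;
  sg_closed : group_closed (mem sg_set)
}.

Definition sgtype (G : groupType) (H : subgroup G) : Type := set_type H.

Section SubgroupType.
Variables (G : groupType) (H : subgroup G).

Lemma sg1 : sg_set H 1.
Proof. by have [/set_mem] := sg_closed H. Qed.

Lemma sgV x : sg_set H x -> sg_set H x^-1.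
Proof.
move=> Hx; have [H1 HB] := sg_closed H.
by have /set_mem := HB _ _ H1 (mem_set Hx); rewrite div1g.
Qed.

Lemma sgM x y : sg_set H x -> sg_set H y -> sg_set H (x * y).
Proof.
move=> Hx /sgV Hy; have [_ HB] := sg_closed H.
by have /set_mem := HB _ _ (mem_set Hx) (mem_set Hy); rewrite invgK.
Qed.

HB.instance Definition _ := SubChoice.copy (sgtype H) (set_type H).
HB.instance Definition _ :=
  SubChoice_isSubGroup.Build _ _ (sgtype H) (sg_closed H).

Lemma sgP (h : sgtype H) : sg_set H (val h).
Proof. exact: set_mem (valP h). Qed.

Lemma sg_val1 : val (1 : sgtype H) = 1.
Proof. by []. Qed.

Lemma sg_valM (x y : sgtype H) : val (x * y) = val x * val y.
Proof. by []. Qed.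

End SubgroupType.

Section SubgroupTopology.
Variables (G : topGroupType) (H : subgroup G).

HB.instance Definition _ := Topological.copy (sgtype H) (set_type H).

Fact val_continuous : continuous (val : sgtype H -> G).
Proof. exact: initial_continuous. Qed.

Fact to_sg_continuous (T : topologicalType) (f : T -> sgtype H) :
  continuous (val \o f) -> continuous f.
Proof. by move=> cf; apply/continuous_comp_initial. Qed.

Fact sg_mul_continuous :
  continuous (fun x : sgtype H * sgtype H => x.1 * x.2).
Proof.
apply: to_sg_continuous => x.
apply: (@continuous_comp _ _ _
  (fun x : sgtype H * sgtype H => (val x.1, val x.2))
  (fun x : G * G => x.1 * x.2)); last exact: mulg_continuous.
by apply: cvg_pair; apply: continuous_comp; 
  (exact: cvg_fst || exact: cvg_snd || exact: val_continuous).
Qed.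

Fact sg_inv_continuous : continuous (fun x : sgtype H => x^-1).
Proof.
apply: to_sg_continuous => x.
apply: (@continuous_comp _ _ _ (val : sgtype H -> G) (fun x : G => x^-1)).
  exact: val_continuous.
exact: invg_continuous.
Qed.

HB.instance Definition _ := isTopologicalGroup.Build (sgtype H)
  sg_mul_continuous sg_inv_continuous.

End SubgroupTopology.

(* The usual definition (Bushnell-Henniart), topological groups being Hausdorff;
   by van Dantzig's theorem it is equivalent to Hausdorff, locally compact and
   totally disconnected. *)
Definition locally_profinite (G : topGroupType) : Prop :=
  hausdorff_space G /\
  forall U : set G, nbhs 1 U ->
    exists C : subgroup G, [/\ open C, compact C & C `<=` U].

Section Representations.
Variables (R : comPzRingType) (G : groupType).

Record rep := Rep {
  rep_mod :> lmodType R;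
  act : G -> rep_mod -> rep_mod;
  act_linear : forall g, linear (act g);
  act1 : forall v, act 1 v = v;
  actM : forall g h v, act (g * h) v = act g (act h v)
}.

HB.instance Definition _ (tau : rep) (g : G) :=
  GRing.isLinear.Build R tau tau *:%R (act g) (@act_linear tau g).

Definition rep_iso (sigma tau : rep) : Prop :=
  exists f : {linear sigma -> tau},
    bijective f /\ forall g v, f (act g v) = act g (f v).

Record subrep (tau : rep) := Subrep {
  sr_set :> set tau;
  sr_closed : submod_closed (mem sr_set);
  sr_stable : forall g v, sr_set v -> sr_set (act g v)
}.

Section SubrepRep.
Variables (tau : rep) (W : subrep tau).

Definition subrep_mod : Type := set_type W.

HB.instance Definition _ := SubChoice.copy subrep_mod (set_type W).
HB.instance Definition _ :=
  GRing.SubChoice_isSubLmodule.Build R tau _ subrep_mod (sr_closed W).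

Definition subrep_act (g : G) (w : subrep_mod) : subrep_mod :=
  Sub (act g (val w)) (mem_set (sr_stable g (set_mem (valP w)))).

Fact subrep_linear g : linear (subrep_act g).
Proof. by move=> a u v; apply: val_inj; rewrite /= linearP. Qed.

Fact subrep_act1 w : subrep_act 1 w = w.
Proof. by apply: val_inj; rewrite /= act1. Qed.

Fact subrep_actM g h w : subrep_act (g * h) w = subrep_act g (subrep_act h w).
Proof. by apply: val_inj; rewrite /= actM. Qed.

Definition subrep_rep : rep := @Rep subrep_mod subrep_act
  subrep_linear subrep_act1 subrep_actM.

End SubrepRep.

Section Product.
Variables (I : Type) (tau : I -> rep).

Definition prod_mod : Type := forall i, tau i.

HB.instance Definition _ := Choice.copy prod_mod (forall i, tau i).

Definition prod_zero : prod_mod := fun=> 0%R.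
Definition prod_opp (x : prod_mod) : prod_mod := fun i => (- x i)%R.
Definition prod_add (x y : prod_mod) : prod_mod := fun i => (x i + y i)%R.
Definition prod_scale (a : R) (x : prod_mod) : prod_mod := fun i => (a *: x i)%R.

Fact prod_addA : associative prod_add.
Proof. by move=> x y z; apply: functional_extensionality_dep => i; exact: addrA. Qed.
Fact prod_addC : commutative prod_add.
Proof. by move=> x y; apply: functional_extensionality_dep => i; exact: addrC. Qed.
Fact prod_add0 : left_id prod_zero prod_add.
Proof. by move=> x; apply: functional_extensionality_dep => i; exact: add0r. Qed.
Fact prod_addN : left_inverse prod_zero prod_opp prod_add.
Proof. by move=> x; apply: functional_extensionality_dep => i; exact: addNr. Qed.

HB.instance Definition _ := GRing.isZmodule.Build prod_mod
  prod_addA prod_addC prod_add0 prod_addN.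

Fact prod_scaleA a b x : prod_scale a (prod_scale b x) = prod_scale (a * b)%R x.
Proof. by apply: functional_extensionality_dep => i; exact: scalerA. Qed.
Fact prod_scale1 : left_id 1%R prod_scale.
Proof. by move=> x; apply: functional_extensionality_dep => i; exact: scale1r. Qed.
Fact prod_scaleDr : right_distributive prod_scale +%R.
Proof. by move=> a x y; apply: functional_extensionality_dep => i; exact: scalerDr. Qed.
Fact prod_scaleDl x : {morph prod_scale^~ x : a b / (a + b)%R}.
Proof. by move=> a b; apply: functional_extensionality_dep => i; exact: scalerDl. Qed.

HB.instance Definition _ := GRing.Zmodule_isLmodule.Build R prod_mod
  prod_scaleA prod_scale1 prod_scaleDr prod_scaleDl.

Definition prod_act (g : G) (x : prod_mod) : prod_mod := fun i => act g (x i).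

Fact prod_act_linear g : linear (prod_act g).
Proof.
by move=> a x y; apply: functional_extensionality_dep => i; exact: linearP.
Qed.
Fact prod_act1 x : prod_act 1 x = x.
Proof. by apply: functional_extensionality_dep => i; exact: act1. Qed.
Fact prod_actM g h x : prod_act (g * h) x = prod_act g (prod_act h x).
Proof. by apply: functional_extensionality_dep => i; exact: actM. Qed.

Definition prod_rep : rep := @Rep prod_mod prod_act
  prod_act_linear prod_act1 prod_actM.

Definition finsupp : set prod_rep :=
  [set x : prod_mod | finite_set [set i | x i <> 0%R]].

Fact finsupp_closed : submod_closed (mem finsupp).
Proof.
split=> [|a x y /set_mem fx /set_mem fy]; apply/mem_set.
  by rewrite /finsupp /= (_ : [set i | _] = set0) // -subset0 => i /=.
have fxy : finite_set ([set i | (x : prod_mod) i <> 0%R] `|`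
  [set i | (y : prod_mod) i <> 0%R]) by rewrite finite_setU.
apply: sub_finite_set fxy => i /=; apply: contra_notP => /not_orP[].
move=> /contrapT xi /contrapT yi.
by rewrite -[LHS]/(a *: (x : prod_mod) i + (y : prod_mod) i)%R xi yi
  scaler0 addr0.
Qed.

Fact finsupp_stable g x : finsupp x -> finsupp (act g x).
Proof.
apply: sub_finite_set => i /=; apply: contra_not => xi.
by rewrite /prod_act xi linear0.
Qed.

Definition dsum_sub : subrep prod_rep := Subrep finsupp_closed finsupp_stable.

Definition dsum_rep : rep := subrep_rep dsum_sub.

End Product.

Section RegularFunctions.
Variable V : lmodType R.

Definition fun_act (g : G) (f : G -> V) : G -> V := fun x => f (x * g).

Fact fun_act_linear g : linear (fun_act g).
Proof. by []. Qed.
Fact fun_act1 f : fun_act 1 f = f.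
Proof. by apply/funext => x; rewrite /fun_act mulg1. Qed.
Fact fun_actM g h f : fun_act (g * h) f = fun_act g (fun_act h f).
Proof. by apply/funext => x; rewrite /fun_act mulgA. Qed.

Definition fun_rep : rep := @Rep (G -> V : lmodType R) fun_act
  fun_act_linear fun_act1 fun_actM.

End RegularFunctions.

End Representations.

Section Pullback.
Variables (R : comPzRingType) (A B : groupType).
Variables (phi : A -> B) (phiM : {morph phi : x y / x * y}) (rho : rep R B).

Definition pullback_act (a : A) (v : rho) : rho := act (phi a) v.

Fact pullback_linear a : linear (pullback_act a).
Proof. exact: act_linear. Qed.
Fact pullback_act1 v : pullback_act 1 v = v.
Proof.
have phi1 : phi 1 = 1 by apply: (@mulgI _ (phi 1)); rewrite -phiM !mulg1.
by rewrite /pullback_act phi1 act1.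
Qed.
Fact pullback_actM a b v :
  pullback_act (a * b) v = pullback_act a (pullback_act b v).
Proof. by rewrite /pullback_act phiM actM. Qed.

Definition pullback : rep R A := @Rep R A rho pullback_act
  pullback_linear pullback_act1 pullback_actM.

End Pullback.

Definition Res (R : comPzRingType) (G : groupType) (K : subgroup G)
    (tau : rep R G) : rep R (sgtype K) :=
  pullback (@sg_valM G K) tau.

Section Conjugation.
Variables (G : groupType) (H : subgroup G) (g : G).

Definition conj_set : set G := [set g * h * g^-1 | h in H].

Fact conj_closed : group_closed (mem conj_set).
Proof.
split=> [|_ _ /set_mem[x Hx <-] /set_mem[y Hy <-]]; apply/mem_set.
  by exists 1; [exact: sg1 | rewrite mulg1 mulgV].
exists (x * y^-1); first by apply: sgM => //; exact: sgV.
by rewrite !invgM invgK !mulgA mulgVK.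
Qed.

Definition conj_sg : subgroup G := Subgroup conj_closed.

Fact unconj_subproof (x : sgtype conj_sg) : g^-1 * val x * g \in sg_set H.
Proof.
by have [h Hh <-] := sgP x; rewrite !mulgA mulVg mul1g mulgVK; apply/mem_set.
Qed.

Definition unconj (x : sgtype conj_sg) : sgtype H :=
  Sub (g^-1 * val x * g) (unconj_subproof x).

Lemma unconjM : {morph unconj : x y / x * y}.
Proof.
by move=> x y; apply: val_inj; rewrite /= !mulgA mulgK.
Qed.

Definition conj_rep (R : comPzRingType) (rho : rep R (sgtype H)) :
    rep R (sgtype conj_sg) :=
  pullback unconjM rho.

End Conjugation.

(* K `&` L as a subgroup of the group K, and restriction from L to K `&` L. *)
Section Intersection.
Variables (G : groupType) (K L : subgroup G).

Definition meet_set : set (sgtype K) := [set k | sg_set L (val k)].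

Fact meet_closed : group_closed (mem meet_set).
Proof.
split=> [|x y /set_mem Lx /set_mem Ly]; apply/mem_set; first exact: sg1.
by apply: sgM => //; exact: sgV.
Qed.

Definition meet_sg : subgroup (sgtype K) := Subgroup meet_closed.

Definition meet_incl (x : sgtype meet_sg) : sgtype L :=
  Sub (val (val x)) (mem_set (sgP x : sg_set L (val (val x)))).

Lemma meet_inclM : {morph meet_incl : x y / x * y}.
Proof. by move=> x y; apply: val_inj. Qed.

Definition Res_meet (R : comPzRingType) (sigma : rep R (sgtype L)) :
    rep R (sgtype meet_sg) :=
  pullback meet_inclM sigma.

End Intersection.

Section Smooth.
Variables (R : comPzRingType) (G : topGroupType) (tau : rep R G).

Definition smooth_vec (v : tau) : Prop :=
  exists U : subgroup G, open U /\ forall u, sg_set U u -> act u v = v.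

Definition smooth : Prop := forall v : tau, smooth_vec v.

Fact meet_subgroup_closed (U W : subgroup G) : group_closed (mem (U `&` W)).
Proof.
split=> [|x y /set_mem[Ux Wx] /set_mem[Uy Wy]]; apply/mem_set.
  by split; exact: sg1.
by split; apply: sgM => //; exact: sgV.
Qed.

Fact smooth_vec_closed : submod_closed (mem [set v | smooth_vec v]).
Proof.
split=> [|a v w /set_mem[U [oU Uv]] /set_mem[W [oW Ww]]]; apply/mem_set.
  exists (@Subgroup G setT (conj (mem_set I) (fun _ _ _ _ => mem_set I))).
  by split=> [|u _]; [exact: openT | exact: linear0].
exists (Subgroup (meet_subgroup_closed U W)); split; first exact: openI.
by move=> u [Uu Wu]; rewrite act_linear Uv// Ww.
Qed.

Fact conj_sg_open (U : subgroup G) g : open U -> open (conj_sg U g).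
Proof.
move=> oU; rewrite (_ : sg_set (conj_sg U g) =
    (fun x => g^-1 * x) @^-1` ((fun x => x * g) @^-1` U)); last first.
  apply/seteqP; split=> [_ [u Uu <-]|x Ux] /=.
    by rewrite !mulgA mulVg mul1g mulgVK.
  by exists (g^-1 * x * g) => //; rewrite !mulgA mulgV mul1g mulgK.
have /continuousP := @mulg_continuousl G g^-1; apply.
by have /continuousP := @mulg_continuousr G g; apply.
Qed.

Fact smooth_vec_stable g v : smooth_vec v -> smooth_vec (act g v).
Proof.
move=> [U [oU Uv]]; exists (conj_sg U g); split; first exact: conj_sg_open.
by move=> _ [u Uu <-]; rewrite -actM mulgVK actM Uv.
Qed.

Definition smooth_sub : subrep tau := Subrep smooth_vec_closed smooth_vec_stable.

Definition smooth_part : rep R G := subrep_rep smooth_sub.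

End Smooth.

Section RightCosets.
Variables (G : groupType) (H : subgroup G).

Definition rcoset_rel : rel G := fun x y => `[< sg_set H (x * y^-1) >].

Fact rcoset_rel_refl : reflexive rcoset_rel.
Proof. by move=> x; apply/asboolP; rewrite mulgV; exact: sg1. Qed.
Fact rcoset_rel_sym : symmetric rcoset_rel.
Proof.
by move=> x y; apply/asboolP/asboolP => /sgV; rewrite invgM invgK.
Qed.
Fact rcoset_rel_trans : transitive rcoset_rel.
Proof.
move=> y x z /asboolP Hxy /asboolP Hyz; apply/asboolP.
by have := sgM Hxy Hyz; rewrite mulgA mulgVK.
Qed.

Canonical rcoset_equiv : equiv_rel G :=
  EquivRel rcoset_rel rcoset_rel_refl rcoset_rel_sym rcoset_rel_trans.

End RightCosets.

(* H\G, the cosets H x with the quotient topology. *)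
Notation rcosets H := (quotient_topology {eq_quot (rcoset_equiv H)}).

Section Induction.
Variables (R : comPzRingType) (G : topGroupType) (H : subgroup G).
Variable rho : rep R (sgtype H).

Definition IND_set : set (fun_rep G rho) :=
  [set f : G -> rho |
    forall (h : sgtype H) (g : G), f (val h * g) = act h (f g)].

Fact IND_closed : submod_closed (mem IND_set).
Proof.
split=> [|a f f' /set_mem fH /set_mem f'H]; apply/mem_set => h g.
  by rewrite linear0.
rewrite -[LHS]/(a *: (f : G -> rho) (val h * g)%g + (f' : G -> rho) (val h * g)%g)%R.
by rewrite fH f'H -act_linear.
Qed.

Fact IND_stable g f : IND_set f -> IND_set (act g f).
Proof.
by move=> fH h x; apply: etrans _ (fH h (x * g)); rewrite /= /fun_act mulgA.
Qed.

Definition IND : rep R G := subrep_rep (Subrep IND_closed IND_stable).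

Definition Ind : rep R G := smooth_part IND.

Definition Ind_fun (f : Ind) : G -> rho := val (val f).

(* Since f is smooth this set is clopen (see Ind_supp_closed), so it agrees with
   its closure. *)
Definition Ind_supp (f : Ind) : set G := [set g | Ind_fun f g <> 0%R].

Definition cInd_set : set Ind :=
  [set f | compact (\pi_(rcosets H) @` Ind_supp f)].

Lemma Ind_funH f (h : sgtype H) g : Ind_fun f (val h * g) = act h (Ind_fun f g).
Proof. exact: (set_mem (valP (val f)) h g). Qed.

Lemma Ind_fun_act g f x : Ind_fun (act g f) x = Ind_fun f (x * g).
Proof. by []. Qed.

Lemma Ind_funP a f f' x :
  Ind_fun (a *: f + f')%R x = (a *: Ind_fun f x + Ind_fun f' x)%R.
Proof. by []. Qed.

Lemma Ind_fun_smooth f : exists2 U : subgroup G, open U &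
  forall u x, sg_set U u -> Ind_fun f (x * u) = Ind_fun f x.
Proof.
have [U [oU Uf]] := set_mem (valP f); exists U => // u x Uu.
by have /(congr1 (fun k : IND => (val k : G -> rho) x)) := Uf _ Uu.
Qed.

Lemma Ind_supp_closed f : closed (\pi_(rcosets H) @` Ind_supp f).
Proof.
rewrite -openC; suff oN : open (~` Ind_supp f).
  rewrite /open /= /quotient_open; congr (open _): oN.
  apply/seteqP; split=> [x fx [y fy xy]|x fx fx']; last by apply: fx; exists x.
  have /asboolP Hyx : rcoset_equiv H y x by apply/eqmodP.
  apply: fy; have := Ind_funH f (Sub (y * x^-1) (mem_set Hyx)) x.
  rewrite /= mulgVK => ->; have /contrapT -> := fx; exact: linear0.
have [U oU Uf] := Ind_fun_smooth f; rewrite openE => x fx.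
rewrite /interior nbhsE; exists ((fun y => x^-1 * y) @^-1` U).
split; first by have /continuousP := @mulg_continuousl G x^-1; apply.
  by rewrite /= mulVg; exact: sg1.
by move=> y Uy; rewrite /Ind_supp /= -[y](mulVKg x) Uf.
Qed.

Fact cInd_closed : submod_closed (mem cInd_set).
Proof.
split=> [|a f f' /set_mem cf /set_mem cf']; apply/mem_set.
  rewrite /cInd_set /= (_ : Ind_supp _ = set0).
    by rewrite image_set0; exact: compact0.
  by rewrite -subset0 => x /=; apply.
apply: subclosed_compact (compactU cf cf') _; first exact: Ind_supp_closed.
rewrite -image_setU; apply: image_subset => x.
rewrite /Ind_supp /= Ind_funP; apply: contra_notP => /not_orP[].
by move=> /contrapT -> /contrapT ->; rewrite scaler0 addr0.
Qed.

Fact cInd_stable g f : cInd_set f -> cInd_set (act g f).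
Proof.
rewrite /cInd_set /= => cf; pose q (x : rcosets H) : rcosets H :=
  \pi_(rcosets H) (repr x * g^-1).
have qE x : q (\pi_(rcosets H) x) = \pi_(rcosets H) (x * g^-1).
  apply/eqmodP/asboolP; rewrite invgM invgK mulgA mulgVK.
  apply/asboolP; have /eqmodP := reprK (\pi_(rcosets H) x); exact.
have cq : continuous q.
  apply/quotient_continuous.
  rewrite (_ : q \o _ = \pi_(rcosets H) \o (fun x => x * g^-1)); last exact/funext.
  move=> x; apply: continuous_comp; first exact: mulg_continuousr.
  exact: pi_continuous.
rewrite (_ : _ @` _ = q @` (\pi_(rcosets H) @` Ind_supp f)).
  by apply: continuous_compact => //; exact: continuous_subspaceT.
apply/seteqP; split=> [_ [x fx <-]|_ [_ [x fx <-] <-]].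
  by exists (\pi_(rcosets H) (x * g)); [exists (x * g) | rewrite qE mulgK].
by exists (x * g^-1); [rewrite /Ind_supp /= Ind_fun_act mulgVK | rewrite qE].
Qed.

Definition cInd : rep R G := subrep_rep (Subrep cInd_closed cInd_stable).

End Induction.

Section DoubleCosets.
Variables (G : groupType) (K H : subgroup G).

Definition dcoset (g : G) : set G :=
  [set x | exists k h, [/\ sg_set K k, sg_set H h & x = k * g * h]].

(* S contains exactly one element of every double coset in K\G/H. *)
Definition dcoset_reps (S : set G) : Prop :=
  forall x : G, exists! g, S g /\ dcoset g x.

Lemma dcoset_eqP g x : dcoset g x -> dcoset x = dcoset g.
Proof.
move=> [k [h [Kk Hh ->]]]; apply/seteqP.
split=> _ [k' [h' [Kk' Hh' ->]]].
  exists (k' * k), (h * h'); split; [exact: sgM | exact: sgM |].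
  by rewrite !mulgA.
exists (k' * k^-1), (h^-1 * h'); split.
- by apply: sgM => //; exact: sgV.
- by apply: sgM => //; exact: sgV.
- by rewrite !mulgA mulgVK mulgK.
Qed.

Lemma dcoset_reps_exist : exists S, dcoset_reps S.
Proof.
have dxx x : dcoset x x.
  by exists 1, 1; split; [exact: sg1 | exact: sg1 | rewrite mul1g mulg1].
pose r x := xget 1 (dcoset x).
have rP x : dcoset x (r x) by apply: xgetI (dxx x).
exists (range r) => x; exists (r x); split.
  by split; [exists x | rewrite (dcoset_eqP (rP x))].
move=> _ [[y _ <-]]; rewrite (dcoset_eqP (rP y)) => /dcoset_eqP xy.
by rewrite /r xy.
Qed.

End DoubleCosets.

(* Main.v *)
(* A left H-equivariant f on G is determined by its components f_g(k) = f(g^-1 k),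
   and any family of equivariant components glues back; everything reduces to
   matching smoothness and support conditions.  For (1), take W = 1 if H is open
   and W a compact open subgroup of K if K is open.  In both cases the sets H y W
   are open and have compact image in H\G, so compactness of the support means
   being covered by finitely many H y W, and this condition passes between f and
   its components.
   For (3), let G = {0,1}^N x Z with Z discrete, H = {0,1}^N, K = 1, R = Z^N, and
   let rho be the smooth part of R, with the n-th coordinate of H acting by a sign
   on the n-th coordinate of R.  Each element of Ind rho is fixed by a single open
   subgroup, hence killed by some basic idempotent e_n; since K = 1 the right-hand
   side is a full product, which contains a family with all the e_n among its
   values, killed by none of them. *)
Require Import Defs.
From HB Require Import structures.
From mathcomp Require Import all_boot all_order all_algebra.
From mathcomp Require Import all_classical all_reals all_analysis.

Set Implicit Arguments.
Unset Strict Implicit.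
Unset Printing Implicit Defensive.

Local Open Scope classical_set_scope.

Import GRing.Theory.
Local Open Scope quotient_scope.
Local Open Scope group_scope.

(** * Finite subcovers, and comparison of representations inside a common target *)

Lemma compact_finite_cover (T : topologicalType) (A : set T) (I : choiceType)
    (f : I -> set T) :
  compact A -> (forall i, open (f i)) -> A `<=` \bigcup_i f i ->
  exists s : seq I, forall x, A x -> exists2 i, i \in s & f i x.
Proof.
move=> cA fo Af; have [A0|/set0P[x0 _]] := eqVneq A set0.
  by exists [::] => x; rewrite A0.
(* [compact_cover] speaks of pointed spaces; the chosen point of [A] becomes the base point. *)
pose T' : ptopologicalType := HB.pack_for ptopologicalType T (isPointed.Build T x0).
have cA' : @compact T' A by [].
rewrite compact_cover in cA'.
have [D _ AD] := cA' I setT f (fun i _ => fo i) Af.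
by exists (finmap.enum_fset D) => x /AD[i iD fx]; exists i.
Qed.

(** The isomorphism is [a] followed by the inverse of [b] on the common image; linearity and
    equivariance are tested after applying the injective [b]. *)
Lemma rep_iso_same_image (R : comPzRingType) (G : groupType)
    (sigma tau E : rep R G) (a : sigma -> E) (b : tau -> E) :
  linear a -> linear b -> injective a -> injective b ->
  (forall g v, a (act g v) = act g (a v)) ->
  (forall g w, b (act g w) = act g (b w)) ->
  (forall v, exists w, b w = a v) -> (forall w, exists v, a v = b w) ->
  rep_iso sigma tau.
Proof.
move=> aL bL aI bI aG bG /choice[phi phiE] /choice[psi psiE].
have phiL : linear phi.
  by move=> r u v; apply: bI; rewrite phiE aL bL !phiE.
pose L := GRing.isLinear.Build R sigma tau *:%R phi phiL.
pose phi' : {linear sigma -> tau} := HB.pack phi L.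
exists phi'; split; last by move=> g v; apply: bI; rewrite /= phiE aG bG phiE.
exists psi => [v|w]; first by apply: aI; rewrite psiE /= phiE.
by apply: bI; rewrite /= phiE psiE.
Qed.

(** * Open double cosets, and subgroups cut out inside [K] *)

Section TopologicalGroups.
Variable G : topGroupType.
Implicit Types (H K U W : subgroup G).

Lemma open_lcoset (A : set G) x : open A -> open [set x * y | y in A].
Proof.
move=> oA; rewrite (_ : _ @` _ = (fun y => x^-1 * y) @^-1` A).
  by have /continuousP := @mulg_continuousl G x^-1; apply.
apply/seteqP; split=> [_ [y Ay <-]|y Ay] /=; first by rewrite mulKg.
by exists (x^-1 * y); rewrite ?mulVKg.
Qed.

Lemma open_rcoset (A : set G) x : open A -> open [set y * x | y in A].
Proof.
move=> oA; rewrite (_ : _ @` _ = (fun y => y * x^-1) @^-1` A).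
  by have /continuousP := @mulg_continuousr G x^-1; apply.
apply/seteqP; split=> [_ [y Ay <-]|y Ay] /=; first by rewrite mulgK.
by exists (y * x^-1); rewrite ?mulgVK.
Qed.

Lemma open_dcoset H W y : open H \/ open W -> open (dcoset H W y).
Proof.
case=> [oH|oW].
  rewrite (_ : dcoset _ _ _ = \bigcup_(w in W) [set x * (y * w) | x in H]).
    by apply: bigcup_open => w _; exact: open_rcoset.
  apply/seteqP; split=> [_ [h [w [Hh Ww ->]]]|_ [w Ww [h Hh <-]]].
    by exists w => //; exists h => //; rewrite mulgA.
  by exists h, w; rewrite mulgA.
rewrite (_ : dcoset _ _ _ = \bigcup_(h in H) [set (h * y) * x | x in W]).
  by apply: bigcup_open => w _; exact: open_lcoset.
apply/seteqP; split=> [_ [h [w [Hh Ww ->]]]|_ [h Hh [w Ww <-]]].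
  by exists h => //; exists w.
by exists h, w.
Qed.

Lemma open_meet_sg K U : open U -> open (meet_sg K U).
Proof. by move=> oU; exists U. Qed.

(** A filter on the intersection, pushed to [G], clusters at a point of [W]. That point lies in [K],
    whose open sets are traces of open sets of [G], so it is a cluster point in [K] as well. *)
Lemma compact_meet_sg K W : W `<=` K -> compact W -> compact (meet_sg K W).
Proof.
move=> WK cW F PF FW.
have [|p [Wp clp]] := cW (val @ F) _; first exact: FW.
pose q : sgtype K := Sub p (mem_set (WK _ Wp)).
exists q; split; first by rewrite /= /meet_set /=.
move=> A B FA; rewrite nbhsE => -[_ [[V oV <-] Vq] VB].
have [|x [[k Ak <-] Vk]] := clp (val @` A) V _ (open_nbhs_nbhs (conj oV Vq)).
  by apply: (@filterS _ F _ A) FA => k Ak; exists k.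
by exists k; split => //; exact: VB.
Qed.

Lemma finite_open_subgroup (J : eqType) (s : seq J) (Q : J -> G -> Prop) :
  (forall i, i \in s -> exists U, open U /\ forall u, sg_set U u -> Q i u) ->
  exists U, open U /\ forall u, sg_set U u -> forall i, i \in s -> Q i u.
Proof.
elim: s => [|i s IH] sQ.
  exists (@Subgroup G setT (conj (mem_set I) (fun _ _ _ _ => mem_set I))).
  by split; first exact: openT.
have [|U [oU UQ]] := sQ i; first by rewrite inE eqxx.
have [j js|V [oV VQ]] := IH; first by apply: sQ; rewrite inE js orbT.
exists (Subgroup (meet_subgroup_closed U V)); split; first exact: openI.
by move=> u [Uu Vu] j; rewrite inE => /orP[/eqP->|]; [exact: UQ | exact: VQ].
Qed.

End TopologicalGroups.

(** * Equivariant functions, smoothness, and compact support modulo [H] *)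

Section Equivariant.
Variables (R : comPzRingType) (G : topGroupType) (H : subgroup G).
Variable rho : rep R (sgtype H).
Implicit Types (f : G -> rho) (W : subgroup G).

(** Smoothness of [f] under right translation: one [U] serves every [x], which is stronger than
    local constancy. *)
Definition unif_loc_const f : Prop :=
  exists2 U : subgroup G, open U & forall u x, sg_set U u -> f (x * u) = f x.

Lemma Ind_fun_inj : injective (@Ind_fun R G H rho).
Proof. by move=> f f' ff'; apply/val_inj/val_inj. Qed.

Lemma Ind_of_fun f : IND_set f -> unif_loc_const f ->
  exists F : Ind rho, Ind_fun F = f.
Proof.
move=> fH [U oU Uf]; pose F0 : IND rho := Sub (f : fun_rep G rho) (mem_set fH).
have F0s : smooth_vec F0.
  by exists U; split=> // u Uu; apply/val_inj/funext => x; exact: Uf.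
by exists (Sub F0 (mem_set F0s)).
Qed.

Lemma IND_act f (x : sgtype H) y : IND_set f -> f (val x * y) = act x (f y).
Proof. exact. Qed.

(** The sets [H y W] have open images in the coset space, and these cover the compact image of the
    support. *)
Lemma cInd_supp_dcosets W (f : Ind rho) : open H \/ open W -> cInd_set f ->
  exists s : seq G, forall x, Ind_fun f x <> 0%R ->
    exists2 y, y \in s & dcoset H W y x.
Proof.
move=> oHW cf.
(* [H y W] is stable under left multiplication by [H], so it is the full preimage of its image. *)
have dE y : \pi_(rcosets H) @^-1` (\pi_(rcosets H) @` dcoset H W y) = dcoset H W y.
  apply/seteqP; split=> [x [z [h [w [Hh Ww ->]]] /eqmodP/asboolP zx]|x]; last by exists x.
  exists ((h * y * w * x^-1)^-1 * h), w; split => //.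
    by apply: sgM => //; exact: sgV.
  by rewrite !invgM invgK !mulgA !mulgVK.
have [y|_ [x fx <-]|s sP] := @compact_finite_cover _ _ G
    (fun y => \pi_(rcosets H) @` dcoset H W y) cf.
- by rewrite /open /= /quotient_open dE; exact: open_dcoset.
- exists x => //; exists x => //; exists 1, 1.
  by rewrite mul1g mulg1; split => //; exact: sg1.
- exists s => x fx; have [|y ys xy] := sP (\pi_(rcosets H) x); first by exists x.
  by exists y => //; rewrite -dE.
Qed.

(** The image of [H y W] is that of [y W], hence compact; the image of the support is closed in a
    finite union of such sets. *)
Lemma dcosets_cInd W (f : Ind rho) (s : seq G) : compact W ->
  (forall x, Ind_fun f x <> 0%R -> exists2 y, y \in s & dcoset H W y x) ->
  cInd_set f.
Proof.
move=> cW sP; apply: subclosed_compact (@Ind_supp_closed _ _ _ _ f) _ _.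
  apply: (@bigsetU_compact _ _ (fun y => (fun w => \pi_(rcosets H) (y * w)) @` W)
    s xpredT) => y _.
  apply: continuous_compact cW; apply: continuous_subspaceT => x.
  apply: continuous_comp; first exact: mulg_continuousl.
  exact: pi_continuous.
move=> _ [x fx <-]; have [y ys [h [w [Hh Ww ->]]]] := sP x fx.
rewrite -bigcup_seq; exists y => //; exists w => //.
apply/eqmodP/asboolP; rewrite !invgM !mulgA mulgK mulgV mul1g; exact: sgV.
Qed.

End Equivariant.

(** * Pointwise formulas, and subgroups of [K] seen in [G] *)

Lemma subrep_valP (R : comPzRingType) (G : groupType) (tau : rep R G)
    (W : subrep tau) r (v w : subrep_rep W) :
  val (r *: v + w)%R = (r *: (val v : tau) + val w)%R.
Proof. by []. Qed.

Lemma subrep_valZ (R : comPzRingType) (G : groupType) (tau : rep R G)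
    (W : subrep tau) r (v : subrep_rep W) :
  val (r *: v)%R = (r *: (val v : tau))%R.
Proof. by []. Qed.

Lemma subrep_val0 (R : comPzRingType) (G : groupType) (tau : rep R G)
    (W : subrep tau) : val (0%R : subrep_rep W) = (0%R : tau).
Proof. by []. Qed.

Lemma prod_repP (R : comPzRingType) (G : groupType) (I : Type)
    (tau : I -> rep R G) r (v w : prod_rep tau) i :
  (r *: v + w : prod_rep tau)%R i = (r *: (v : forall i, tau i) i + w i)%R.
Proof. by []. Qed.

Lemma Ind_fun0 (R : comPzRingType) (G : topGroupType) (H : subgroup G)
    (rho : rep R (sgtype H)) x : Ind_fun (0%R : Ind rho) x = 0%R.
Proof. by []. Qed.

Lemma Ind_funZ (R : comPzRingType) (G : topGroupType) (H : subgroup G)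
    (rho : rep R (sgtype H)) r (v : Ind rho) x :
  Ind_fun (r *: v)%R x = (r *: Ind_fun v x)%R.
Proof. by rewrite -[(r *: v)%R]addr0 Ind_funP Ind_fun0 addr0. Qed.

Definition cInd_fun (R : comPzRingType) (G : topGroupType) (H : subgroup G)
    (rho : rep R (sgtype H)) (f : cInd rho) : G -> rho := Ind_fun (val f).

Section CInd.
Variables (R : comPzRingType) (G : topGroupType) (H : subgroup G).
Variable rho : rep R (sgtype H).

Lemma cInd_funP r (v w : cInd rho) x :
  cInd_fun (r *: v + w)%R x = (r *: cInd_fun v x + cInd_fun w x)%R.
Proof. by rewrite -Ind_funP -subrep_valP. Qed.

Lemma cInd_fun_act g (f : cInd rho) x : cInd_fun (act g f) x = cInd_fun f (x * g).
Proof. exact: (@Ind_fun_act _ _ _ _ g (val f)). Qed.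

Lemma cInd_fun_inj : injective (@cInd_fun R G H rho).
Proof. by move=> v w vw; apply/val_inj/Ind_fun_inj. Qed.
End CInd.

Section ImageSubgroup.
Variables (G : topGroupType) (K : subgroup G) (U : subgroup (sgtype K)).

Fact image_sg_closed : group_closed (mem [set val u | u in U]).
Proof.
split=> [|_ _ /set_mem[x Ux <-] /set_mem[y Uy <-]]; apply/mem_set.
  by exists 1; first exact: sg1.
by exists (x * y^-1); first by apply: sgM => //; exact: sgV.
Qed.

Definition image_sg : subgroup G := Subgroup image_sg_closed.

Lemma open_image_sg : open K -> open U -> open image_sg.
Proof.
move=> oK [V oV VU]; rewrite (_ : sg_set image_sg = K `&` V); first exact: openI.
apply/seteqP; split=> [_ [u Uu <-]|x [Kx Vx]].
  by split; [exact: sgP | move: Uu; rewrite -VU].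
by exists (Sub x (mem_set Kx)) => //; rewrite -VU.
Qed.

End ImageSubgroup.

Lemma trivial_closed (G : groupType) : group_closed (mem [set (1 : G)]).
Proof.
by split=> [|_ _ /set_mem-> /set_mem->]; apply/mem_set => //=; rewrite mulgV.
Qed.

Definition trivial_sg (G : groupType) : subgroup G := Subgroup (trivial_closed G).

(** Two factorizations of one point through the same [g] have [K]-parts that differ by an element of
    [g H g^-1]; this makes gluing well defined. *)
Lemma cross_ratio (G : groupType) (g h h' k k' : G) :
  h * g^-1 * k = h' * g^-1 * k' -> k * k'^-1 = g * (h^-1 * h') * g^-1.
Proof.
by rewrite -!mulgA => e; apply: (mulIg k'); rewrite -!mulgA mulVg mulg1 -e mulKg mulVKg.
Qed.

(** * Components of an equivariant function, and the decomposition of [Ind] *)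

Section Mackey.
Variables (R : comPzRingType) (G : topGroupType) (H K : subgroup G).
Variables (rho : rep R (sgtype H)) (S : set G).
Hypothesis Sreps : dcoset_reps K H S.
Implicit Types (f : G -> rho) (U W : subgroup G) (g : set_type S).

Local Notation rhog g := (Res_meet K (conj_rep g rho)).
(** The common target for both sides: the module underlying [rhog g] is that of [rho], whatever [g]
    is. *)
Local Notation E :=
  (prod_rep (fun _ : set_type S => fun_rep (sgtype K) rho)).

(* The inverse [g^-1] appears because [f] is equivariant on the left, so that its
   support is a union of double cosets [H g^-1 K]. *)
Definition mackey (f : G -> rho) : E :=
  fun g k => f ((val g)^-1 * val k).

Lemma mackey_decomp x : exists (h : sgtype H) (g : set_type S) (k : sgtype K),
  x = val h * (val g)^-1 * val k.
Proof.
(* The representatives describe [K g H], so [x^-1] is factored first and the result inverted. *)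
have [g [[Sg [k [h [Kk Hh xE]]]] _]] := Sreps x^-1.
exists (Sub h^-1 (mem_set (sgV Hh))), (Sub g (mem_set Sg)),
  (Sub k^-1 (mem_set (sgV Kk))).
by rewrite /= -[x]invgK xE !invgM mulgA.
Qed.

Lemma mackey_decomp_inj (h h' : sgtype H) (g g' : set_type S) (k k' : sgtype K) :
  val h * (val g)^-1 * val k = val h' * (val g')^-1 * val k' -> g = g'.
Proof.
move=> e; have [y [_ yU]] := Sreps (val h * (val g)^-1 * val k)^-1.
have yg : y = val g.
  apply: yU; split; first exact: set_mem (valP g).
  exists (val k)^-1, (val h)^-1; split; [exact/sgV/sgP | exact/sgV/sgP |].
  by rewrite !invgM invgK mulgA.
have yg' : y = val g'.
  apply: yU; split; first exact: set_mem (valP g').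
  exists (val k')^-1, (val h')^-1; split; [exact/sgV/sgP | exact/sgV/sgP |].
  by rewrite -[LHS]/(_ * _ * _)^-1 e !invgM invgK mulgA.
by apply: val_inj; rewrite -yg -yg'.
Qed.

(** For [h] in [g H g^-1], [g^-1 h = (g^-1 h g) g^-1], so equivariance of [f] under [H] becomes
    equivariance under the conjugate action. *)
Lemma mackey_IND f (g : set_type S) :
  IND_set f -> IND_set (mackey f g : fun_rep (sgtype K) (rhog (val g))).
Proof.
move=> fH h k; rewrite /mackey /= /pullback_act.
rewrite -[RHS](fH (unconj (meet_incl h))) /=.
by congr f; rewrite !mulgA mulgK.
Qed.

Lemma mackey_inj f f' : IND_set f -> IND_set f' -> mackey f = mackey f' -> f = f'.
Proof.
move=> fH fH' ff'; apply/funext => x; have [h [g [k ->]]] := mackey_decomp x.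
rewrite -!mulgA (IND_act _ _ fH) (IND_act _ _ fH').
by have /(congr1 (fun F : E => F g k)) := ff'; rewrite /mackey => ->.
Qed.

(** The glued function sends [h g^-1 k] to [act h (F g k)]. Independence of the factorization
    ([fwd]) is the equivariance of [F g] under the intersection of [K] with [g H g^-1]. *)
Lemma mackey_surj (F : E) :
  (forall g, IND_set (F g : fun_rep (sgtype K) (rhog (val g)))) ->
  exists2 f, IND_set f & mackey f = F.
Proof.
move=> FH.
have fwd (h h' : sgtype H) (g : set_type S) (k k' : sgtype K) :
    val h * (val g)^-1 * val k = val h' * (val g)^-1 * val k' ->
    act h (F g k) = act h' (F g k').
  move=> /cross_ratio ke.
  have cj : sg_set (conj_sg H (val g)) (val (k * k'^-1)).
    by rewrite /= ke; exists (val (h^-1 * h')) => //; exact: sgP.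
  pose m : sgtype (meet_sg K (conj_sg H (val g))) := Sub (k * k'^-1) (mem_set cj).
  have := FH g m k'; rewrite /= mulgVK /= /pullback_act => ->.
  rewrite -actM; congr (act _ _); apply: val_inj => /=.
  have cancel (a b c : G) : a * b^-1 * b * a^-1 * c * b^-1 * b = c.
    by rewrite !mulgVK mulgV mul1g.
  by rewrite ke !mulgA; exact: cancel.
have [f fE] : exists f : G -> rho, forall h (g : set_type S) k,
    f (val h * (val g)^-1 * val k) = act h (F g k).
  have /choice[f fP] : forall x, exists v, forall h (g : set_type S) k,
      x = val h * (val g)^-1 * val k -> v = act h (F g k).
    move=> x; have [h [g [k ->]]] := mackey_decomp x.
    exists (act h (F g k)) => h' g' k' e.
    by have gg := mackey_decomp_inj e; subst g'; exact: fwd.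
  by exists f => h g k; exact: fP.
exists f; last first.
  apply: functional_extensionality_dep => g; apply/funext => k.
  by have := fE 1 g k; rewrite /= mul1g act1.
move=> h x; have [h' [g [k ->]]] := mackey_decomp x.
by rewrite [in RHS]fE -actM -fE /= !mulgA.
Qed.

Lemma mackey_act (k : sgtype K) (v : Ind rho) :
  mackey (Ind_fun (act (val k) v)) = act k (mackey (Ind_fun v) : E) :> E.
Proof.
apply: functional_extensionality_dep => g; apply/funext => x.
rewrite [LHS]/mackey Ind_fun_act.
change (act k (mackey (Ind_fun v)) g x)
  with (Ind_fun v ((val g)^-1 * (val x * val k))).
by rewrite mulgA.
Qed.

Lemma mackey_shift U f g (u k : sgtype K) :
  (forall u x, sg_set U u -> f (x * u) = f x) -> sg_set (meet_sg K U) u ->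
  mackey f g (k * u) = mackey f g k.
Proof. by move=> Uf Uu; rewrite /mackey /= mulgA Uf. Qed.

Lemma mackey_unif_loc_const f g : unif_loc_const f ->
  unif_loc_const (mackey f g : sgtype K -> rhog (val g)).
Proof.
move=> [U oU Uf]; exists (meet_sg K U); first exact: open_meet_sg.
by move=> u k; exact: mackey_shift.
Qed.

(** A subgroup open in the open subgroup [K] is open in [G], and right translation by it only moves
    the [K]-part of [h g^-1 k]. *)
Lemma unif_loc_const_mackey f (U : subgroup (sgtype K)) :
  open K -> open U -> IND_set f ->
  (forall g u k, sg_set U u -> mackey f g (k * u) = mackey f g k) ->
  unif_loc_const f.
Proof.
move=> oK oU fH Uf; exists (image_sg U); first exact: open_image_sg.
move=> _ x [u Uu <-]; have [h [g [k ->]]] := mackey_decomp x.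
rewrite -!mulgA !(IND_act _ _ fH) /=; congr (act _ _).
exact: Uf g u k Uu.
Qed.

Lemma Ind_mackey f g : IND_set f -> unif_loc_const f ->
  exists w : Ind (rhog (val g)), Ind_fun w = mackey f g.
Proof.
move=> fH fU; apply: Ind_of_fun; first exact: mackey_IND.
exact: mackey_unif_loc_const.
Qed.

(** An open subgroup fixing [v] fixes all components at once, so the family is a smooth vector of
    the product. Conversely, smoothness of a family gives a single [U] for all [g], as
    [unif_loc_const_mackey] requires. *)
Lemma mackey_Ind : open K ->
  rep_iso (Res K (Ind rho))
    (smooth_part (prod_rep (fun g : set_type S => Ind (rhog (val g))))).
Proof.
move=> oK; set tau := prod_rep _.
pose b (w : smooth_part tau) : E := fun g k => Ind_fun ((val w : tau) g) k.
pose a (v : Res K (Ind rho)) : E := mackey (Ind_fun v).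
have aL : linear a.
  move=> r v v'; apply: functional_extensionality_dep => g; apply/funext => k.
  exact: (@Ind_funP _ _ _ rho r v v' ((val g)^-1 * val k)).
have bL : linear b.
  move=> r v v'; apply: functional_extensionality_dep => g; apply/funext => k.
  exact: (@Ind_funP _ _ _ (rhog (val g)) r ((val v : tau) g) ((val v' : tau) g) k).
apply: (@rep_iso_same_image R _ (Res K (Ind rho)) (smooth_part tau) E a b aL bL).
- move=> v v' /mackey_inj vv'; apply: Ind_fun_inj; apply: vv' => h x; exact: Ind_funH.
- move=> w w' ww'; apply/val_inj/functional_extensionality_dep => g.
  by apply: Ind_fun_inj; exact: (congr1 (fun F : E => F g) ww').
- by move=> k v; exact: mackey_act.
- move=> k w; apply: functional_extensionality_dep => g; apply/funext => x.
  exact: (@Ind_fun_act _ _ _ (rhog (val g)) k ((val w : tau) g) x).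
- move=> v; have fH : IND_set (Ind_fun v) by move=> h x; exact: Ind_funH.
  have [U oU Uf] := Ind_fun_smooth v.
  have wP g : exists w : Ind (rhog (val g)), Ind_fun w = mackey (Ind_fun v) g.
    by apply: Ind_mackey fH _; exists U.
  pose w : tau := fun g => sval (cid (wP g)).
  have wE g : Ind_fun (w g) = mackey (Ind_fun v) g := svalP (cid (wP g)).
  have ws : smooth_vec w.
    exists (meet_sg K U); split; first exact: open_meet_sg.
    move=> u Uu; apply: functional_extensionality_dep => g; apply: Ind_fun_inj.
    by apply/funext => k; rewrite [LHS]Ind_fun_act wE; exact: mackey_shift Uf Uu.
  exists (Sub w (mem_set ws)); apply: functional_extensionality_dep => g.
  exact: wE.
- move=> w; have [f fH fw] := @mackey_surj (b w) (fun g h k => Ind_funH _ h k).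
  have [U [oU Uw]] := set_mem (valP w).
  have [|v vf] := @Ind_of_fun _ _ _ rho f fH; last by exists v; rewrite /a vf.
  apply: (unif_loc_const_mackey oK oU fH) => g u k Uu; rewrite fw /b.
  rewrite -(@Ind_fun_act _ _ _ (rhog (val g)) u ((val w : tau) g) k).
  exact: (congr1 (fun x : tau => Ind_fun (x g) k) (Uw u Uu)).
Qed.

(** * Finite support conditions, and the decomposition of [cInd] *)

Lemma unif_loc_const_finite_cosets f (s : seq G) : open H -> smooth rho ->
  IND_set f ->
  (forall x, f x <> 0%R -> exists2 y, y \in s & dcoset H (trivial_sg G) y x) ->
  unif_loc_const f.
Proof.
move=> oH rhos fH sP.
have [y ys|U [oU Us]] := @finite_open_subgroup G _ s (fun y u => f (y * u) = f y).
  have [U [oU Uf]] := rhos (f y).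
  (* For [u] fixing [f y], [f (y * (y^-1 * u * y)) = f (u * y) = f y]. *)
  exists (conj_sg (image_sg U) y^-1); split; first exact/conj_sg_open/open_image_sg.
  move=> _ [_ [u Uu <-] <-].
  by rewrite invgK !mulgA mulgV mul1g (IND_act _ _ fH) Uf.
have Uf u x : sg_set U u -> f x <> 0%R -> f (x * u) = f x.
  move=> Uu /sP[y ys [h [_ [Hh -> ->]]]]; rewrite mulg1 -mulgA.
  pose h' : sgtype H := Sub h (mem_set Hh).
  by rewrite -[h]/(val h') !(IND_act _ _ fH) Us.
(* Off the support, a nonzero value at [x * u] would be carried back to [x] by [u^-1]. *)
exists U => // u x Uu; have [fx|/(Uf _ _ Uu)//] := pselect (f x = 0%R).
rewrite fx; apply: contrapT => fxu; apply: (fxu).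
by rewrite -(Uf _ _ (sgV Uu) fxu) mulgK.
Qed.

Lemma dcosets_mackey W f g (s : seq G) : W `<=` K ->
  (forall x, f x <> 0%R -> exists2 y, y \in s & dcoset H W y x) ->
  exists t : seq (sgtype K), forall k, mackey f g k <> 0%R ->
    exists2 y, y \in t & dcoset (meet_sg K (conj_sg H (val g))) (meet_sg K W) y k.
Proof.
(* [c y] is a point of [K] with [g^-1 (c y)] in [H y]. The default [1] occurs only when [H y] misses
   [g^-1 K], and no such [y] is met below. *)
move=> WK sP; pose c y : sgtype K := xget 1 [set k | exists h,
  sg_set H h /\ (val g)^-1 * val k = h * y].
exists [seq c y | y <- s] => k /sP[y ys [h [w [Hh Ww kE]]]].
exists (c y); first exact: map_f.
pose w' : sgtype K := Sub w (mem_set (WK _ Ww)).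
have /(@xgetPex _ 1)[h' [Hh' cE]] : exists k0 : sgtype K,
    exists h, sg_set H h /\ (val g)^-1 * val k0 = h * y.
  by exists (k * w'^-1), h; rewrite /= mulgA kE mulgK.
rewrite -/(c y) in cE.
exists (k * w'^-1 * (c y)^-1), w'; split => //; last by rewrite !mulgVK.
exists (h * h'^-1); first by apply: sgM => //; exact: sgV.
rewrite -[RHS]/(val k * w^-1 * (val (c y))^-1).
have -> : val k = val g * (h * y * w) by rewrite -kE mulVKg.
have -> : val (c y) = val g * (h' * y) by rewrite -cE mulVKg.
by rewrite !invgM !mulgA !mulgK.
Qed.

(** The centres are the [g^-1 y] for the finitely many [g] in [t]; a factor [g h' g^-1] on the left
    of [y] passes through [g^-1] and becomes [h'] in [H]. *)
Lemma mackey_dcosets W f (t : seq (set_type S)) :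
  IND_set f ->
  (forall g, mackey f g <> 0%R -> g \in t) ->
  (forall g, exists s : seq (sgtype K), forall k, mackey f g k <> 0%R ->
    exists2 y, y \in s & dcoset (meet_sg K (conj_sg H (val g))) (meet_sg K W) y k) ->
  exists s : seq G, forall x, f x <> 0%R -> exists2 y, y \in s & dcoset H W y x.
Proof.
move=> fH ft /choice[s sP].
exists [seq (val g)^-1 * val k | g <- t, k <- s g] => x.
have [h [g [k ->]]] := mackey_decomp x; rewrite -mulgA (IND_act _ _ fH) => fk.
have {}fk : mackey f g k <> 0%R.
  by apply: contra_not fk => e; rewrite -[f _]/(mackey f g k) e linear0.
have [y ys [c [w [[h' Hh' cE] Ww kE]]]] := sP g k fk.
exists ((val g)^-1 * val y).
  apply: (allpairs_f_dep
    (fun (g : set_type S) (k : sgtype K) => (val g)^-1 * val k) _ ys).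
  by apply: ft => f0; apply: fk; rewrite f0.
exists (val h * h'), (val w); split => //; first by apply: sgM => //; exact: sgP.
by rewrite kE /= -cE !mulgA mulgVK.
Qed.

(** Since [W] lies in [K], each [H y W] lies in a single [H g^-1 K] and so meets only one
    component. *)
Lemma finite_mackey W f (s : seq G) : W `<=` K ->
  (forall x, f x <> 0%R -> exists2 y, y \in s & dcoset H W y x) ->
  finite_set [set g : set_type S | mackey f g <> 0%R].
Proof.
move=> WK sP; have /choice[c cP] : forall y, exists g : set_type S,
    exists (h : sgtype H) (k : sgtype K), y = val h * (val g)^-1 * val k.
  by move=> y; have [h [g [k yE]]] := mackey_decomp y; exists g, h, k.
apply: (@sub_finite_set _ _ [set` [seq c y | y <- s]]); last exact: finite_seq.
move=> g /= gf; have [k fk] : exists k, mackey f g k <> 0%R.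
  apply: contrapT => /forallNP fg; apply: gf; apply/funext => k.
  by apply: contrapT; exact: (fg k).
have [y ys [h [w [Hh Ww kE]]]] := sP _ fk.
have [h' [k' yE]] := cP y; apply/mapP; exists y => //.
pose h1 : sgtype H := Sub h (mem_set Hh).
pose w1 : sgtype K := Sub w (mem_set (WK _ Ww)).
apply: (@mackey_decomp_inj 1 (h1 * h') g (c y) k (k' * w1)).
by rewrite /= mul1g kE {1}yE !mulgA.
Qed.

Lemma mackey_cInd_act (k : sgtype K) (v : cInd rho) :
  mackey (cInd_fun (act (val k) v)) = act k (mackey (cInd_fun v) : E) :> E.
Proof. by rewrite -mackey_act; congr mackey. Qed.

Lemma mackey_cInd : locally_profinite G -> smooth rho -> open H \/ open K ->
  rep_iso (Res K (cInd rho)) (dsum_rep (fun g : set_type S => cInd (rhog (val g)))).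
Proof.
move=> [_ Gprof] rhos oHK; set tau := prod_rep (fun g => cInd (rhog (val g))).
have [W [WK cW oHW]] : exists W : subgroup G,
    [/\ W `<=` K, compact W & open H \/ open W].
  case: oHK => [oH|oK].
    exists (trivial_sg G); split; [|exact: compact_set1|by left].
    by move=> _ ->; exact: sg1.
  have [|W [oW cW WK]] := Gprof K; last by exists W; split => //; right.
  by apply: open_nbhs_nbhs; split => //; exact: sg1.
have oHW' g : open (meet_sg K (conj_sg H (val g))) \/ open (meet_sg K W).
  case: oHW => [oH|oW]; [left | right]; last exact: open_meet_sg.
  exact/open_meet_sg/conj_sg_open.
have cW' := compact_meet_sg WK cW.
pose a (v : Res K (cInd rho)) : E := mackey (cInd_fun v).
pose b (w : dsum_rep (fun g : set_type S => cInd (rhog (val g)))) : E :=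
  fun g k => cInd_fun ((val w : tau) g) k.
have aL : linear a.
  move=> r v v'; apply: functional_extensionality_dep => g; apply/funext => k.
  exact: (@cInd_funP _ _ _ rho r v v' ((val g)^-1 * val k)).
have bL : linear b.
  move=> r v v'; apply: functional_extensionality_dep => g; apply/funext => k.
  by rewrite /b subrep_valP prod_repP cInd_funP.
apply: (@rep_iso_same_image R _ (Res K (cInd rho)) (dsum_rep _) E a b aL bL).
- move=> v v' /mackey_inj vv'; apply: cInd_fun_inj.
  by apply: vv' => h x; exact: Ind_funH.
- move=> w w' ww'; apply/val_inj/functional_extensionality_dep => g.
  by apply: cInd_fun_inj; exact: (congr1 (fun F : E => F g) ww').
- by move=> k v; exact: mackey_cInd_act.
- move=> k w; apply: functional_extensionality_dep => g; apply/funext => x.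
  exact: (@cInd_fun_act _ _ _ (rhog (val g)) k ((val w : tau) g) x).
- move=> v; have cv : cInd_set (val v) := set_mem (valP v).
  have fH : IND_set (Ind_fun (val v)) by move=> h x; exact: Ind_funH.
  have fU : unif_loc_const (Ind_fun (val v)) := Ind_fun_smooth (val v).
  have [s sP] := cInd_supp_dcosets oHW cv.
  have wP g : exists w : cInd (rhog (val g)),
      Ind_fun (val w) = mackey (Ind_fun (val v)) g.
    have [w wE] := Ind_mackey g fH fU.
    have [t tP] := dcosets_mackey g WK sP.
    have cw : cInd_set w by apply: dcosets_cInd cW' _ => k; rewrite wE; exact: tP.
    by exists (Sub w (mem_set cw)).
  pose w : tau := fun g => sval (cid (wP g)).
  have wE g : Ind_fun (val (w g)) = mackey (Ind_fun (val v)) g :=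
    svalP (cid (wP g)).
  have wf : finsupp w.
    apply: sub_finite_set (finite_mackey WK sP) => g /=; apply: contra_not => fg.
    by apply/val_inj/Ind_fun_inj; rewrite wE fg.
  exists (Sub w (mem_set wf)); apply: functional_extensionality_dep => g.
  exact: wE.
- move=> w; have [f fH fw] := @mackey_surj (b w) (fun g h k => Ind_funH _ h k).
  have /finite_seqP[t tE] : finsupp (val w : tau) := set_mem (valP w).
  have wt g : mackey f g <> 0%R -> g \in t.
    rewrite fw; apply: contra_notT => gt; apply/funext => k; rewrite /b.
    suff -> : (val w : tau) g = 0%R by [].
    apply: contrapT => wg; move/negP: gt; apply.
    by have : [set i | (val w : tau) i <> 0%R] g := wg; rewrite tE.
  (* Stated for any [W']: the trivial subgroup gives smoothness of [f] when [H] is open, and [W]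
     gives compact support. *)
  have supp W' :
      (forall g, open (meet_sg K (conj_sg H (val g))) \/ open (meet_sg K W')) ->
      exists s : seq G, forall x, f x <> 0%R ->
        exists2 y, y \in s & dcoset H W' y x.
    move=> oW'; apply: (mackey_dcosets fH wt) => g; rewrite fw.
    exact: cInd_supp_dcosets (oW' _) (set_mem (valP ((val w : tau) g))).
  have fU : unif_loc_const f.
    case: oHK => [oH|oK].
      have [|s] := supp (trivial_sg G); last exact: unif_loc_const_finite_cosets.
      by move=> g; left; exact/open_meet_sg/conj_sg_open.
    have [g _|U [oU Ut]] := @finite_open_subgroup (sgtype K) _ t
        (fun g u => forall k, mackey f g (k * u) = mackey f g k).
      have [U oU Uw] := Ind_fun_smooth (val ((val w : tau) g)).
      by exists U; split => // u Uu k; rewrite fw; exact: Uw.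
    apply: (unif_loc_const_mackey oK oU fH) => g u k Uu.
    (* Zero components are invariant under everything, so [U] only has to serve the finite list
       [t]. *)
    have [->//|/eqP/wt gt] := eqVneq (mackey f g) 0%R.
    exact: Ut.
  have [v vf] := Ind_of_fun fH fU.
  have [s sP] := supp W oHW'.
  have cv : cInd_set v by apply: dcosets_cInd cW _ => x; rewrite vf; exact: sP.
  by exists (Sub v (mem_set cv)); rewrite /a /cInd_fun SubK vf.
Qed.

End Mackey.

(** * The locally profinite group [{0,1}^N x Z] *)

Lemma nbhs_cantorE (x : cantor_space) (A : set cantor_space) :
  nbhs x A <-> exists n, forall y : cantor_space, (forall i, i < n -> y i = x i)%N -> A y.
Proof.
split=> [|[n nA]].
  pose F : set_system cantor_space :=
    [set A | exists n, forall y, (forall i, i < n -> y i = x i)%N -> A y].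
  have FF : Filter F.
    split; first by exists 0%N.
      move=> P Q [n nP] [m mQ]; exists (maxn n m) => y yx; split.
        by apply: nP => i ni; apply: yx; rewrite leq_max ni.
      by apply: mQ => i mi; apply: yx; rewrite leq_max mi orbT.
    by move=> P Q PQ [n nP]; exists n => y /nP /PQ.
  suff Fx : F --> x by move=> xA; exact: (Fx A xA).
  (* The product topology is a supremum of initial topologies, so convergence is tested on one
     coordinate; a prefix of length [i.+1] determines coordinate [i]. *)
  apply/cvg_sup => i U [V [[W oW <-] Wx] VU]; apply: filterS VU _.
  by exists i.+1 => y yx /=; rewrite yx.
have nbhsn : nbhs x [set y : cantor_space | forall i, (i < n)%N -> y i = x i].
  elim: n {nA} => [|n IHn]; first by apply: filterS filterT.
  have xn : nbhs x [set y : cantor_space | y n = x n].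
    have nb : nbhs (x n) [set x n].
      by apply: open_nbhs_nbhs; split => //; exact: discrete_open.
    exact: (@proj_continuous nat (fun=> bool) n x _ nb).
  apply: filterS (filterI IHn xn) => y [yx yn] i.
  by rewrite ltnS leq_eqVlt => /orP[/eqP->//|]; exact: yx.
by apply: filterS nbhsn.
Qed.

Definition cantor_int : Type := (cantor_space * discrete_topology int)%type.

HB.instance Definition _ :=
  Topological.copy cantor_int (cantor_space * discrete_topology int)%type.

Definition ci_mul (x y : cantor_int) : cantor_int :=
  (fun n => x.1 n (+) y.1 n, (x.2 : int) + y.2)%R.
Definition ci_one : cantor_int := (fun=> false, 0%R : int).
(** Addition of bits is exclusive or, so the Cantor part is its own inverse. *)
Definition ci_inv (x : cantor_int) : cantor_int := (x.1, - (x.2 : int))%R.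

Fact ci_mulA : associative ci_mul.
Proof.
by move=> x y z; congr pair; [apply/funext => n; exact: addbA | exact: addrA].
Qed.
Fact ci_mulC : commutative ci_mul.
Proof.
by move=> x y; congr pair; [apply/funext => n; exact: addbC | exact: addrC].
Qed.
Fact ci_mul1 : left_id ci_one ci_mul.
Proof. by move=> [x i]; congr pair; exact: add0r. Qed.
Fact ci_mulV : left_inverse ci_one ci_inv ci_mul.
Proof.
by move=> x; congr pair; [apply/funext => n; exact: addbb | exact: addNr].
Qed.
Fact ci_mulr1 : right_id ci_one ci_mul.
Proof. by move=> x; rewrite ci_mulC ci_mul1. Qed.
Fact ci_mulVr : right_inverse ci_one ci_inv ci_mul.
Proof. by move=> x; rewrite ci_mulC ci_mulV. Qed.

HB.instance Definition _ := isGroup.Build cantor_int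
  ci_mulA ci_mul1 ci_mulr1 ci_mulV ci_mulVr.

Definition agree n (x : cantor_int) : set cantor_int :=
  [set y | (forall i, (i < n)%N -> y.1 i = x.1 i) /\ y.2 = x.2].

Lemma nbhs_ciE (x : cantor_int) (A : set cantor_int) :
  nbhs x A <-> exists n, agree n x `<=` A.
Proof.
split=> [[[B C] [/nbhs_cantorE[n nB] xC] BCA]|[n nA]].
  exists n => y [yx1 yx2]; apply: BCA; split; first exact: nB.
  by rewrite yx2; exact: nbhs_singleton xC.
exists ([set y | forall i, (i < n)%N -> y i = x.1 i], [set x.2]); last first.
  by move=> y [y1 y2]; exact: nA.
split; first by apply/nbhs_cantorE; exists n.
by apply: open_nbhs_nbhs; split => //; exact: discrete_open.
Qed.

Fact ci_mul_continuous : continuous (fun x : cantor_int * cantor_int => x.1 * x.2).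
Proof.
move=> x A /nbhs_ciE[n nA].
exists (agree n x.1, agree n x.2); first by split; apply/nbhs_ciE; exists n.
move=> y [[y1 y1'] [y2 y2']]; apply: nA; split => [i ni|].
  by rewrite /= y1// y2.
by rewrite /= y1' y2'.
Qed.

Fact ci_inv_continuous : continuous (fun x : cantor_int => x^-1).
Proof.
move=> x A /nbhs_ciE[n nA]; apply/nbhs_ciE; exists n => y [y1 y2].
by apply: nA; split; [exact: y1 | rewrite /= y2].
Qed.

HB.instance Definition _ := isTopologicalGroup.Build cantor_int
  ci_mul_continuous ci_inv_continuous.

Lemma open_ciP (A : set cantor_int) :
  open A <-> forall x, A x -> exists n, agree n x `<=` A.
Proof.
rewrite openE; split=> [oA x /oA|oA x /oA]; by move/nbhs_ciE.
Qed.

Lemma ci_hausdorff : hausdorff_space cantor_int.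
Proof.
move=> x y xy; have xyn n : agree n x y.
  have nb z : nbhs z (agree n z) by apply/nbhs_ciE; exists n.
  have [z [[xz1 xz2] [yz1 yz2]]] := xy _ _ (nb x) (nb y).
  by split; [move=> i ni; rewrite -xz1// yz1 | rewrite -xz2 yz2].
rewrite [x]surjective_pairing [y]surjective_pairing; congr pair.
  by apply/funext => i; have [/(_ i (ltnSn i))] := xyn i.+1.
by have [_] := xyn 0%N.
Qed.

Fact cylinder_closed n : group_closed (mem (agree n 1)).
Proof.
split=> [|x y /set_mem[x1 x2] /set_mem[y1 y2]]; apply/mem_set => //.
split=> [i ni|]; first by rewrite /= x1// y1.
by rewrite /= x2 y2.
Qed.

Definition cylinder n : subgroup cantor_int := Subgroup (cylinder_closed n).

Lemma open_cylinder n : open (cylinder n).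
Proof.
apply/open_ciP => x [x1 x2]; exists n => y [y1 y2].
by split; [move=> i ni; rewrite y1// x1 | rewrite y2].
Qed.

(** The cylinders form a neighbourhood basis of [1]; each is closed inside the compact image of the
    Cantor space at integer coordinate [0]. *)
Lemma ci_locally_profinite : locally_profinite cantor_int.
Proof.
split; first exact: ci_hausdorff.
move=> U /nbhs_ciE[n nU]; exists (cylinder n); split => //.
  exact: open_cylinder.
pose inj (x : cantor_space) : cantor_int := (x, 0%R : int).
have inj_cont : continuous inj.
  move=> x A /nbhs_ciE[m mA]; apply/nbhs_cantorE; exists m => y yx.
  by apply: mA.
apply: (subclosed_compact _ (continuous_compact
  (continuous_subspaceT inj_cont) cantor_space_compact)).
  rewrite -openC; apply/open_ciP => x nx; exists n => y [y1 y2] [y3 y4].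
  by apply: nx; split; [move=> i ni; rewrite -y1// y3 | rewrite -y2].
by move=> [x i] [_ /= ->]; exists x.
Qed.

Fact snd_zero_closed : group_closed (mem [set x : cantor_int | x.2 = (0%R : int)]).
Proof.
split=> [|x y /set_mem/= x2 /set_mem/= y2]; apply/mem_set => //=.
by rewrite x2 y2.
Qed.

Definition cantor_sg : subgroup cantor_int := Subgroup snd_zero_closed.

Lemma open_cantor_sg : open cantor_sg.
Proof. by apply/open_ciP => x x2; exists 0%N => y [_ y2]; rewrite /= y2. Qed.

Lemma closed_cantor_sg : closed cantor_sg.
Proof.
rewrite -openC; apply/open_ciP => x x2; exists 0%N => y [_ y2] /=.
by rewrite y2.
Qed.

(** * The sign representation and its smooth part *)

Definition sign_act (h : sgtype cantor_sg) (v : (nat -> int)^o) : (nat -> int)^o :=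
  fun n => (if (val h).1 n then - v n else v n)%R.

Fact sign_act_linear h : linear (sign_act h).
Proof.
move=> a v w; apply/funext => n; rewrite /sign_act.
rewrite -[LHS]/(if _ then - (a n * v n + w n) else a n * v n + w n)%R.
rewrite -[RHS]/(a n * (if _ then _ else _) + (if _ then _ else _))%R.
by case: ifP => // _; rewrite opprD mulrN.
Qed.
Fact sign_act1 v : sign_act 1 v = v.
Proof. by []. Qed.
Fact sign_actM g h v : sign_act (g * h) v = sign_act g (sign_act h v).
Proof.
apply/funext => n; rewrite /sign_act /=.
by case: (_ .1 n) (_ .1 n) => [] [] //=; rewrite opprK.
Qed.

Definition sign_rep : rep (nat -> int) (sgtype cantor_sg) :=
  @Rep (nat -> int) _ (nat -> int)^o sign_act sign_act_linear sign_act1 sign_actM.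

(** The constant sequence [1] is fixed by the identity alone, so [sign_rep] itself is not smooth. *)
Definition sign_smooth_rep : rep (nat -> int) (sgtype cantor_sg) :=
  smooth_part sign_rep.

Lemma smooth_part_smooth (R : comPzRingType) (G : topGroupType) (tau : rep R G) :
  smooth (smooth_part tau).
Proof.
move=> v; have [U [oU Uv]] := set_mem (valP v).
by exists U; split => // u Uu; apply: val_inj; exact: Uv.
Qed.

(** Primitive idempotents of the product ring, serving both as vectors and as scalars that project
    to one coordinate. *)
Definition idem n : nat -> int := fun i => (i == n)%:R%R.

Lemma idem_smooth n : @smooth_vec (nat -> int) _ sign_rep (idem n).
Proof.
(* Bit [n] itself must vanish, hence [n.+1]. *)
exists (meet_sg cantor_sg (cylinder n.+1)); split.
  exact/open_meet_sg/open_cylinder.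
move=> h [h1 _]; apply/funext => i; rewrite /= /sign_act /idem.
have [->|] := eqVneq i n; first by rewrite h1.
by rewrite oppr0 if_same.
Qed.

Definition idem_vec n : sign_smooth_rep :=
  Sub (idem n : sign_rep) (mem_set (idem_smooth n)).

Lemma sign_repZ r (v : sign_rep) i :
  (r *: v : sign_rep)%R i = (r i * (v : nat -> int) i)%R.
Proof. by []. Qed.

(** * Annihilators distinguish the two sides *)

(** A subgroup fixing [v] contains a cylinder of some level [n], hence the element [u] of [H]
    flipping only bit [n]. By commutativity [act u] fixes every value of [v], so coordinate [n] of
    each value equals its own negative and vanishes. *)
Lemma Ind_sign_annihilated (v : Ind sign_smooth_rep) : exists n, (idem n *: v = 0)%R.
Proof.
have [U oU Uv] := Ind_fun_smooth v.
have /nbhs_ciE[n nU] : nbhs 1 (sg_set U).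
  by apply: open_nbhs_nbhs; split => //; exact: sg1.
exists n; pose u : cantor_int := (fun i => i == n, 0%R : int).
have Uu : sg_set U u.
  by apply: nU; split => // i ni; rewrite /= ltn_eqF.
have Hu : sg_set cantor_sg u by [].
pose h : sgtype cantor_sg := Sub u (mem_set Hu).
apply: Ind_fun_inj; apply/funext => x; rewrite Ind_funZ Ind_fun0.
have hv : act h (Ind_fun v x) = Ind_fun v x.
  by rewrite -(Ind_funH v h) -(Uv u x Uu); congr (Ind_fun v _); exact: ci_mulC.
pose a : nat -> int := val (Ind_fun v x).
have ha i : sign_act h a i = a i.
  exact: (congr1 (fun y : sign_smooth_rep => (val y : nat -> int) i) hv).
apply: val_inj; rewrite subrep_valZ subrep_val0; apply/funext => i.
rewrite sign_repZ -/a; move: (ha i).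
rewrite /sign_act /idem /=; case: eqP => _; last by rewrite mul0r.
by rewrite mul1r => /eqP; rewrite Num.Theory.eqNr => /eqP.
Qed.

Lemma const_Ind (g : cantor_int) (x : sign_smooth_rep) :
  exists w : Ind (Res_meet (trivial_sg cantor_int) (conj_rep g sign_smooth_rep)),
    Ind_fun w = fun=> x.
Proof.
apply: Ind_of_fun => [h k|].
  have -> : h = 1 by do 2!apply: val_inj; exact: (sgP (val h)).
  by rewrite act1.
by exists (meet_sg _ (cylinder 0)); first exact/open_meet_sg/open_cylinder.
Qed.

(** An isomorphism is linear over the ring, so the vector [W] would be killed by some [idem n]; but
    one of its components has the constant value [idem_vec n]. *)
Lemma mackey_Ind_fails (S : set cantor_int) :
  dcoset_reps (trivial_sg cantor_int) cantor_sg S ->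
  ~ rep_iso (Res (trivial_sg cantor_int) (Ind sign_smooth_rep))
      (smooth_part (prod_rep (fun g : set_type S =>
         Ind (Res_meet (trivial_sg cantor_int) (conj_rep (val g) sign_smooth_rep))))).
Proof.
move=> Sreps [f [[f' _ ff'] _]].
(* Double cosets are told apart by the integer coordinate; [absz] makes it an index, and the
   nonnegative integers already reach every [n]. *)
pose p (g : set_type S) : nat := absz ((val g).2 : int).
pose w g := sval (cid (const_Ind (val g) (idem_vec (p g)))).
have wE g : Ind_fun (w g) = fun=> idem_vec (p g).
  exact: svalP (cid (const_Ind (val g) (idem_vec (p g)))).
pose tau := prod_rep (fun g : set_type S =>
  Ind (Res_meet (trivial_sg cantor_int) (conj_rep (val g) sign_smooth_rep))).
have ws : @smooth_vec _ _ tau w.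
  exists (meet_sg _ (cylinder 0)); split; first exact/open_meet_sg/open_cylinder.
  move=> u _; have -> : u = 1 by apply: val_inj; exact: (sgP u).
  exact: act1.
pose W : smooth_part tau := Sub (w : tau) (mem_set ws).
have [n nW] := Ind_sign_annihilated (f' W).
have {}nW : (idem n *: W = 0)%R by rewrite -[W]ff' -linearZ nW linear0.
(* The representative of the double coset of [(0, n)] has integer coordinate [n], since [H] and [K]
   leave that coordinate unchanged. *)
have [g [[Sg [k [h [k1 h2 xE]]]] _]] := Sreps (fun=> false, Posz n).
pose g' : set_type S := Sub g (mem_set Sg).
have pg : p g' = n.
  have : (Posz n : int) = (0 + (g.2 : int) + (h.2 : int))%R.
    by have := congr1 snd xE; rewrite k1.
  by rewrite h2 addr0 add0r /p /= => <-.
have : (idem n *: (w g') = 0)%R.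
  exact: (congr1 (fun y : smooth_part tau => (val y : tau) g') nW).
move=> /(congr1 (fun y => Ind_fun y 1)); rewrite Ind_funZ wE Ind_fun0 pg.
move=> /(congr1 (fun y : sign_smooth_rep => (val y : sign_rep))).
rewrite subrep_valZ subrep_val0 => /(congr1 (fun y : nat -> int => y n)).
by rewrite sign_repZ /= /idem eqxx.
Qed.

Theorem theorem1p1 :
  (forall (G : topGroupType) (H K : subgroup G) (R : comPzRingType)
      (rho : rep R (sgtype H)) (S : set G),
    locally_profinite G -> closed H -> closed K -> smooth rho ->
    dcoset_reps K H S ->
    (open H \/ open K ->
      rep_iso (Res K (cInd rho))
        (dsum_rep (fun g : set_type S =>
           cInd (Res_meet K (conj_rep (val g) rho)))))
    /\
    (open K ->
      rep_iso (Res K (Ind rho))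
        (smooth_part (prod_rep (fun g : set_type S =>
           Ind (Res_meet K (conj_rep (val g) rho)))))))
  /\
  (exists (G : topGroupType) (H K : subgroup G) (R : comPzRingType)
      (rho : rep R (sgtype H)),
    [/\ locally_profinite G, closed H, closed K & smooth rho] /\
    open H /\
    forall S : set G, dcoset_reps K H S ->
      ~ rep_iso (Res K (Ind rho))
          (smooth_part (prod_rep (fun g : set_type S =>
             Ind (Res_meet K (conj_rep (val g) rho)))))).
Proof.
split=> [G H K R rho S Gprof _ _ rhos Sreps|].
  by split=> [oHK|oK]; [exact: mackey_cInd | exact: mackey_Ind].
exists cantor_int, cantor_sg, (trivial_sg cantor_int), (nat -> int), sign_smooth_rep.
split; last by split; [exact: open_cantor_sg | exact: mackey_Ind_fails].
split; [exact: ci_locally_profinite | exact: closed_cantor_sg | |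
  exact: smooth_part_smooth].
apply: accessible_closed_set1; apply: hausdorff_accessible; exact: ci_hausdorff.
Qed.
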